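(* Let $a_0=0$ and, for $n\ge 1$, let $a_n$ be the $n$th entry of the infinite list $A$ defined below, and let $s_n=a_0+a_1+\cdots+a_n$. For each nonnegative integer $h$, let $k(h)=\max\{k\ge 0 : s_k\le 2^h\}$, and let $T^h$ be the complete binary tree of height $h$. Then for each nonnegative integer $h$, \[ \pi^*(T^h)\le 2^h-k(h). \]
   Context: The list $A$: let $A_1=(5)$ and for $k\ge 2$ let $A_k$ be the concatenation $A_{k-1},A_{k-1},(1)$ (so $A_2=(5,5,1)$, $A_3=(5,5,1,5,5,1,1)$). Each $A_{k-1}$ is a prefix of $A_k$, and $A$ is the limiting infinite list. A complete binary tree of height $h$ is a rooted tree in which every non-leaf vertex has exactly two children and all leaves are at distance $h$ from the root. A pebbling configuration on a graph $G=(V,E)$ is a function $f:V\to\mathbb{Z}_{\ge 0}$ (number of pebbles at each vertex). A pebbling move removes two pebbles from a vertex and places one pebble on an adjacent vertex. A configuration $f$ pebbles $G$ if for every vertex $v$ some (possibly empty) sequence of pebbling moves brings a pebble to $v$. The optimal pebbling number $\pi^*(G)$ is the minimum total number of pebbles $\sum_v f(v)$ over all configurations $f$ that pebble $G$. *)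

(* Defs.v *)
From mathcomp Require Import all_boot.
From mathcomp Require Import boolp.
From Stdlib Require Import Relation_Operators.

Set Implicit Arguments.
Unset Strict Implicit.
Unset Printing Implicit Defensive.

(* A_0 is a filler: the lists of interest start at A_1 = (5). *)
Fixpoint Alist (k : nat) : seq nat :=
  match k with
  | 0 => [::]
  | 1 => [:: 5]
  | k'.+1 => Alist k' ++ Alist k' ++ [:: 1]
  end.

(* A_n has 2^n - 1 >= n entries, so the n-th entry of the limiting list can be
   read off A_n; see a_limit. *)
Definition a_seq (n : nat) : nat :=
  if n is m.+1 then nth 0 (Alist n) m else 0.

Definition s_seq (n : nat) : nat := \sum_(0 <= i < n.+1) a_seq i.

Lemma AlistS k : 0 < k -> Alist k.+1 = Alist k ++ Alist k ++ [:: 1].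
Proof. by case: k. Qed.

Lemma size_Alist k : (size (Alist k)).+1 = 2 ^ k.
Proof.
elim: k => [//|[|k] IHk //].
by rewrite AlistS // !size_cat /= expnS -IHk addn1 !addnS mul2n -addnn addSn addnS.
Qed.

Lemma prefix_Alist k : prefix (Alist k) (Alist k.+1).
Proof. by case: k => [//|k]; rewrite (@AlistS k.+1) ?prefix_prefix. Qed.

Lemma a_limit n k : n < k -> nth 0 (Alist k) n = a_seq n.+1.
Proof.
move=> lt_nk; rewrite -(subnKC lt_nk); elim: (k - n.+1) => [|d IHd].
  by rewrite addn0.
rewrite addnS -IHd AlistS ?addSn // nth_cat ifT //.
rewrite -ltnS size_Alist; apply: (@leq_trans n.+2); first by [].
apply: leq_trans (ltn_expl _ (ltnSn 1)).
by rewrite !ltnS leq_addr.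
Qed.

Lemma Alist_gt0 k : all (ltn 0) (Alist k).
Proof. by elim: k => [//|[//|k] IHk]; rewrite AlistS // !all_cat IHk. Qed.

Lemma a_gt0 n : 0 < a_seq n.+1.
Proof.
apply: (allP (Alist_gt0 n.+1)); apply: mem_nth.
by rewrite -ltnS size_Alist ltn_expl.
Qed.

Lemma leq_s n : n <= s_seq n.
Proof.
elim: n => [//|n IHn]; have := leq_add IHn (a_gt0 n).
by rewrite addn1 /s_seq [in X in _ -> X]big_nat_recr.
Qed.

Lemma k_exists h : exists k, s_seq k <= 2 ^ h.
Proof. by exists 0; rewrite /s_seq big_nat1. Qed.

Lemma k_bounded h k : s_seq k <= 2 ^ h -> k <= 2 ^ h.
Proof. exact: leq_trans (leq_s k). Qed.

Definition k_max (h : nat) : nat := ex_maxn (k_exists h) (@k_bounded h).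

Record sgraph := SGraph {
  vertex :> finType;
  edge : rel vertex;
  edge_sym : symmetric edge;
  edge_irrefl : irreflexive edge }.

Definition config (G : sgraph) := {ffun G -> nat}.

Definition total (G : sgraph) (f : config G) : nat := \sum_(v : G) f v.

Definition pebbling_move (G : sgraph) (f g : config G) : Prop :=
  exists u v : G, [/\ edge u v, 2 <= f u &
    g = [ffun w => if w == u then f w - 2
                   else if w == v then f w + 1 else f w]].

Definition pebbles (G : sgraph) (f : config G) : Prop :=
  forall v : G, exists2 g : config G,
    clos_refl_trans_1n _ (@pebbling_move G) f g & 0 < g v.

Definition pebbled_with (G : sgraph) (n : nat) : Prop :=
  exists2 f : config G, pebbles f & total f = n.

Lemma pebbled_with_exists (G : sgraph) : exists n, `[< pebbled_with G n >].
Proof.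
pose f : config G := [ffun=> 1]; exists (total f); apply/asboolP; exists f => //.
by move=> v; exists f; [exact: rt1n_refl | rewrite ffunE].
Qed.

Definition opt_pebbling (G : sgraph) : nat := ex_minn (pebbled_with_exists G).

(* The default value #|G| is returned when y is not reachable from x. *)
Definition dist (G : sgraph) (x y : G) : nat :=
  find (fun n => [exists p : n.-tuple G, path (@edge G) x p && (last x p == y)])
       (iota 0 #|G|).

Lemma dist_le (G : sgraph) (x : G) (p : seq G) :
  path (@edge G) x p -> dist x (last x p) <= size p.
Proof.
move=> xp; rewrite /dist; set P := (P in find P _).
have Pp : P (size p).
  by apply/existsP; exists (in_tuple p); rewrite /= xp eqxx.
case: (ltnP (size p) #|G|) => [lt_pG | /(leq_trans _) -> //]; last first.
  by rewrite -[X in _ <= X](size_iota 0) find_size.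
rewrite leqNgt; apply/negP=> /(before_find 0).
by rewrite nth_iota // add0n Pp.
Qed.

Lemma dist_path (G : sgraph) (x y : G) : connect (@edge G) x y ->
  exists p, [/\ path (@edge G) x p, last x p = y & size p = dist x y].
Proof.
case/connectP=> p0 xp0 ->; case/shortenP: xp0 => p xp Up _.
rewrite /dist; set P := (P in find P _).
have lt_pG : size p < #|G| by have /card_uniqP/= <- := Up; exact: max_card.
have hasP : has P (iota 0 #|G|).
  apply/hasP; exists (size p); first by rewrite mem_iota.
  by apply/existsP; exists (in_tuple p); rewrite /= xp eqxx.
have := nth_find 0 hasP; rewrite nth_iota ?add0n; last first.
  by rewrite -[X in _ < X](size_iota 0) -has_find.
case/existsP=> q /andP[xq /eqP lq]; exists q; split=> //; exact: size_tuple.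
Qed.

Definition is_tree (G : sgraph) : Prop :=
  [/\ 0 < #|G|,
      (forall x y : G, connect (@edge G) x y) &
      (forall c : seq G, uniq c -> cycle (@edge G) c -> size c <= 2)].

Definition children (G : sgraph) (r v : G) : {set G} :=
  [set u | edge v u & dist r u == (dist r v).+1].

Definition is_leaf (G : sgraph) (r v : G) : Prop := children r v = set0.

Definition complete_binary_tree (G : sgraph) (r : G) (h : nat) : Prop :=
  [/\ is_tree G,
      (forall v : G, ~ is_leaf r v -> #|children r v| = 2) &
      (forall v : G, is_leaf r v -> dist r v = h)].

(* Main.v *)
Require Import Defs.
From mathcomp Require Import all_boot.
From mathcomp Require Import boolp zify.
From Stdlib Require Import Relation_Operators.

Set Implicit Arguments.
Unset Strict Implicit.
Unset Printing Implicit Defensive.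

(** Write [k] greedily as a sum of [m] numbers [2^i - 1]; the recursion for the
    lists [A_j] gives [s_k = 3k + 2m].  Let [z_d] be the number of parts with [i >= d] and
    [K_d] the sum of the [2^(i-d) - 1], so that [K_d = z_(d+1) + 2 K_(d+1)].
    Put [2 (z_d - z_(d+1))] pebbles on each vertex of depth [d], and
    [2^h - 3k - 2m] more on the root.  Each subtree rooted at depth [d] can then
    gather [2 z_d] pebbles at its root without outside help.  Hence a vertex of
    depth [d] collects [2^(h-d) - 3 K_d > 0] pebbles: half of what its parent
    collects without it, plus its own [2 z_d].  The total used is [2^h - k]. *)

(** * Calculus of composable pebbling strategies on an arbitrary graph *)

Section Gathering.
Variable G : sgraph.
Implicit Types (f g k : G -> nat) (u v : G).

(* The quantification over all larger configurations [F] makes the relation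
   stable under adding idle pebbles. *)
Definition gathers f g := forall F : config G, (forall x, f x <= F x) ->
  exists2 F' : config G, clos_refl_trans_1n _ (@pebbling_move G) F F' &
    forall x, F x + g x <= F' x + f x.

Definition pile v n : G -> nat := fun x => n * (x == v).

Lemma gathers_geq f g : (forall x, g x <= f x) -> gathers f g.
Proof.
by move=> le_gf F _; exists F => [|x]; [exact: rt1n_refl | rewrite leq_add2l].
Qed.

Lemma gathers_refl f : gathers f f.
Proof. exact: gathers_geq. Qed.

Lemma gathers_trans g f k : gathers f g -> gathers g k -> gathers f k.
Proof.
move=> fg gk F le_fF; have [F1 FF1 le1] := fg F le_fF.
have [|F2 F12 le2] := gk F1; first by move=> x; have := le1 x; have := le_fF x; lia.
exists F2 => [|x]; last by have := le1 x; have := le2 x; lia.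
elim: FF1 F12 => // A B C AB _ IH /IH; exact: rt1n_trans.
Qed.

Lemma gathersW f' g' f g : gathers f' g' ->
  (forall x, f' x <= f x) -> (forall x, g x <= g' x) -> gathers f g.
Proof.
move=> fg le_f le_g; apply: gathers_trans (gathers_geq le_f) _.
exact: gathers_trans fg (gathers_geq le_g).
Qed.

Lemma gathersD f g f' g' : gathers f g -> gathers f' g' ->
  gathers (fun x => f x + f' x) (fun x => g x + g' x).
Proof.
have frame A B C : gathers A B -> gathers (fun x => A x + C x) (fun x => B x + C x).
  move=> AB F le_F; have [|F' FF' le_F'] := AB F.
    by move=> x; apply: leq_trans (le_F x); exact: leq_addr.
  by exists F' => // x; have := le_F' x; lia.
move=> fg f'g'; apply: gathers_trans (frame _ _ f' fg) _.
by apply: gathersW (frame _ _ g f'g') _ _ => x; lia.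
Qed.

Lemma gathers_edge u v n : edge u v -> gathers (pile u (2 * n)) (pile v n).
Proof.
move=> uv; elim: n => [|n IHn]; first exact: gathers_geq.
have one : gathers (pile u 2) (pile v 1).
  move=> F le_F; pose F' : config G := [ffun w =>
    if w == u then F w - 2 else if w == v then F w + 1 else F w].
  have Fu : 2 <= F u by have := le_F u; rewrite /pile eqxx.
  exists F'; first by apply: rt1n_trans (rt1n_refl _ _ _); exists u, v.
  move=> x; have := le_F x; rewrite /F' /pile ffunE.
  case: (eqVneq x u) => [->|_]; last by case: eqP => _ /=; lia.
  by case: (eqVneq u v) uv => [->|_ _]; [rewrite edge_irrefl | move=> /=; lia].
by apply: gathersW (gathersD one IHn) _ _ => x; rewrite /pile; lia.
Qed.

Lemma sum_pile v n : \sum_x pile v n x = n.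
Proof.
rewrite (bigD1 v) //= {1}/pile eqxx muln1 big1 ?addn0 // => x /negPf neq.
by rewrite /pile neq muln0.
Qed.

Lemma opt_pebbling_le f :
  (forall u, gathers f (pile u 1)) -> opt_pebbling G <= \sum_x f x.
Proof.
move=> fP; rewrite /opt_pebbling; case: ex_minnP => n _; apply.
apply/asboolP; exists [ffun x => f x] => [u|]; last first.
  by apply: eq_bigr => x _; rewrite ffunE.
have [|F' FF' /(_ u)] := fP u [ffun x => f x]; first by move=> x; rewrite ffunE.
by rewrite ffunE /pile eqxx => le; exists F' => //; lia.
Qed.

End Gathering.

(** * Arithmetic of the parts and of the list [Alist] *)

Section Parts.
Implicit Types (p : seq nat) (d i : nat).

Definition parts_from p d := count (leq d) p.

(* Parts [i <= d] contribute [0] because of the truncated subtraction. *)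
Definition parts_sum p d := \sum_(i <- p) (2 ^ (i - d)).-1.

Lemma parts_fromS p d : parts_from p d.+1 <= parts_from p d.
Proof. by apply: sub_count => i; exact: ltnW. Qed.

Lemma parts_sumS p d :
  parts_sum p d = parts_from p d.+1 + 2 * parts_sum p d.+1.
Proof.
rewrite /parts_sum /parts_from; elim: p => [|i p IH]; first by rewrite !big_nil.
rewrite !big_cons /= IH.
have -> : (2 ^ (i - d)).-1 = (d < i) + 2 * (2 ^ (i - d.+1)).-1; last by lia.
case: (ltnP d i) => [lt_di|le_id].
  by rewrite -[i - d]prednK ?subn_gt0 // expnS subnS; have := expn_gt0 2 (i - d).-1; lia.
by rewrite (eqP (_ : i - d == 0)) ?subn_eq0 // (eqP (_ : i - d.+1 == 0)) // subn_eq0; lia.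
Qed.

Lemma parts_sum_eq0 p d : parts_from p d = 0 -> parts_sum p d = 0.
Proof.
rewrite /parts_from /parts_sum => /eqP; rewrite -leqn0 leqNgt -has_count => /hasPn le_p.
apply: big1_seq => i /= /le_p; rewrite -ltnNge => /ltnW.
by rewrite -subn_eq0 => /eqP->.
Qed.

(** Since [z_d >= z_(d+1)], expanding [K_d] gives [2 z_d + 3 K_d >= 2 (2 z_(d+1) + 3 K_(d+1))], so
    the bound halves at each level. *)
Lemma parts_bound p h d : 2 * parts_from p 0 + 3 * parts_sum p 0 <= 2 ^ h ->
  d <= h -> 2 * parts_from p d + 3 * parts_sum p d <= 2 ^ (h - d).
Proof.
move=> le0; elim: d => [|d IHd lt_dh]; first by rewrite subn0.
have := IHd (ltnW lt_dh); rewrite (parts_sumS p d) -(subnSK lt_dh) expnS.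
by have := parts_fromS p d; lia.
Qed.

Lemma sumn_Alist j : 0 < j -> sumn (Alist j) = 3 * (2 ^ j).-1 + 2.
Proof.
elim: j => // -[//|j] IHj _; rewrite AlistS // !sumn_cat IHj //= [2 ^ j.+2]expnS.
by have := expn_gt0 2 j.+1; lia.
Qed.

(** Greedy decomposition along the recursive lists: each complete block [Alist i] met by the prefix
    is one part [i], and contributes [3 (2^i - 1) + 2] to the sum. *)
Lemma sumn_take_Alist j n : n < 2 ^ j -> exists p,
  parts_sum p 0 = n /\ sumn (take n (Alist j)) = 3 * n + 2 * size p.
Proof.
elim: j n => [|j IHj] n lt_n.
  by exists [::]; rewrite /parts_sum big_nil; case: n lt_n.
have size_j := size_Alist j; have size_j1 := size_Alist j.+1.
have [eq_n|neq_n] := eqVneq n (2 ^ j.+1).-1.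
  exists [:: j.+1]; rewrite /parts_sum big_seq1 subn0 eq_n; split=> //.
  by rewrite take_oversize ?sumn_Alist // -size_j1.
have [lt_nj|le_jn] := ltnP n (2 ^ j).
  have [p [pn sp]] := IHj n lt_nj; exists p; split=> //; rewrite -sp.
  have /prefixP[s ->] := prefix_Alist j.
  by rewrite takel_cat //; lia.
case: j => [|j] in IHj lt_n size_j size_j1 neq_n le_jn *.
  by move: lt_n le_jn neq_n; rewrite /= expn1 expn0; lia.
(* The prefix covers the first copy of [Alist j.+1], which is one part, and ends within the second
   copy. *)
have [|p [pn sp]] := IHj (n - size (Alist j.+1)).
  by move: lt_n neq_n; rewrite [2 ^ j.+2]expnS; lia.
exists (j.+1 :: p); rewrite /parts_sum big_cons subn0; split.
  by rewrite -/(parts_sum p 0) pn; lia.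
rewrite AlistS // take_cat ifF; last by lia.
rewrite takel_cat; last by move: lt_n neq_n; rewrite [2 ^ j.+2]expnS; lia.
by rewrite sumn_cat sp sumn_Alist // -[size (_ :: p)]/(size p).+1; lia.
Qed.

Lemma s_seqE n : s_seq n = sumn (take n (Alist n)).
Proof.
have := size_Alist n; have := ltn_expl n (ltnSn 1) => lt_n size_n.
have st : size (take n (Alist n)) = n by rewrite size_takel //; lia.
rewrite /s_seq big_nat_recl // add0n sumnE [RHS](big_nth 0) st.
by apply: eq_big_nat => i /andP[_ lt_in]; rewrite nth_take // a_limit.
Qed.

Lemma s_seq_parts n : exists p,
  parts_sum p 0 = n /\ s_seq n = 3 * n + 2 * parts_from p 0.
Proof.
have [p [pn sp]] := @sumn_take_Alist n n (ltn_expl n (ltnSn 1)).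
by exists p; split=> //; rewrite s_seqE sp /parts_from (eq_count (a2 := predT)) ?count_predT.
Qed.

End Parts.

(** * Pebbling the complete binary tree *)

Section BinaryTree.
Variables (T : sgraph) (r : T) (h : nat).
Hypothesis hT : complete_binary_tree r h.

Let child_rel := [rel x y | y \in children r x].

Lemma dist_root_edge u v : edge u v -> dist r v <= (dist r u).+1.
Proof.
case: hT => -[_ conn _] _ _ uv; have [q [rq lq <-]] := dist_path (conn r u).
have := @dist_le T r (rcons q v); rewrite last_rcons size_rcons; apply.
by rewrite rcons_path rq lq.
Qed.

(** A shortest path from the root descends one level at each edge. *)
Lemma child_pathP u : exists2 p, path child_rel r p & last r p = u.
Proof.
have [n] := ubnP (dist r u); elim: n u => // n IHn u lt_un.
case: hT => -[_ conn _] _ _; have [q] := dist_path (conn r u).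
case/lastP: q => [|q x] [rq lq sq]; first by exists [::].
move: rq lq sq; rewrite rcons_path last_rcons size_rcons => /andP[rq e] ? sq; subst x.
have le_y := @dist_le _ _ _ rq; have le_u := dist_root_edge e.
have [|p rp lp] := IHn (last r q); first by lia.
exists (rcons p u); rewrite ?last_rcons // rcons_path rp lp /= inE e /=.
by apply/eqP; lia.
Qed.

(** A vertex farthest from the root has no children, hence is a leaf. *)
Lemma dist_root_le v : dist r v <= h.
Proof.
case: hT => _ _ leafP.
have [m _ m_max] := @arg_maxnP _ r predT (dist r) isT.
apply: leq_trans (m_max v isT) _; rewrite leafP //.
apply/setP=> x; rewrite !inE; apply/negP=> /andP[_ /eqP dx].
by have := m_max x isT; rewrite dx /=; lia.
Qed.

Lemma childrenP v : dist r v < h -> exists a b, children r v = [set a; b].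
Proof.
case: hT => _ card2 leafP lt_vh.
have /eqP/cards2P[a [b [_ ->]]] : #|children r v| = 2.
  by apply: card2 => /leafP eq_vh; rewrite eq_vh ltnn in lt_vh.
by exists a, b.
Qed.

Variable p : seq nat.
Hypothesis p_le : 2 * parts_from p 0 + 3 * parts_sum p 0 <= 2 ^ h.

(** The outside help for a vertex of depth [d]: with its own [2 z_d] it makes [2^(h-d) - 3 K_d]. By
    [parts_bound] the subtractions do not truncate for [d <= h]. *)
Let surplus d := 2 ^ (h - d) - 3 * parts_sum p d - 2 * parts_from p d.

(** Induction from the leaves up: the configurations of the two child subtrees are joined by a pile
    at [v]. *)
Lemma subtree_config v : exists g : T -> nat,
  let d := dist r v in
  [/\ \sum_x g x = 2 * parts_from p d + 2 * parts_sum p d,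
      gathers g (pile v (2 * parts_from p d)) &
      forall q, path child_rel v q ->
        gathers (fun x => g x + pile v (surplus d) x) (pile (last v q) 1)].
Proof.
have [n] := ubnP (h - dist r v); elim: n v => // n IHn v lt_n /=.
have bound_v := parts_bound p_le (dist_root_le v).
have [lt_vh|le_hv] := ltnP (dist r v) h; last first.
  have eq_v : dist r v = h by have := dist_root_le v; lia.
  (* At depth [h] the bound is [2 z_h + 3 K_h <= 1]; the leaf starts empty and its surplus is 1. *)
  have [z0 K0] : parts_from p h = 0 /\ parts_sum p h = 0.
    by move: bound_v; rewrite eq_v subnn; lia.
  rewrite /surplus eq_v z0 K0 subnn; exists (fun=> 0); split.
  - by rewrite big1.
  - exact: gathers_geq.
  - case=> [_|x q /= /andP[]]; first exact: gathers_geq.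
    by rewrite inE eq_v => /andP[_ /eqP dx]; have := dist_root_le x; lia.
have [a [b eq_ab]] := childrenP lt_vh.
have childE x : x \in children r v -> edge v x /\ dist r x = (dist r v).+1.
  by rewrite inE => /andP[? /eqP].
have [va da] : edge v a /\ dist r a = (dist r v).+1.
  by apply: childE; rewrite eq_ab !inE eqxx.
have [vb db] : edge v b /\ dist r b = (dist r v).+1.
  by apply: childE; rewrite eq_ab !inE eqxx orbT.
have [|ga [sa ua ca]] := IHn a; first by lia.
have [|gb [sb ub cb]] := IHn b; first by lia.
rewrite {}da in sa ua ca; rewrite {}db in sb ub cb.
move: (dist r v) lt_vh bound_v sa ua ca sb ub cb {IHn lt_n childE}.
move=> d lt_dh bound_d sa ua ca sb ub cb.
have zS := parts_fromS p d; have KS := parts_sumS p d.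
have bound_d1 := parts_bound p_le lt_dh.
have pow : 2 ^ (h - d) = 2 * 2 ^ (h - d.+1) by rewrite -(subnSK lt_dh) expnS.
set z := parts_from p d in bound_d zS *.
set z' := parts_from p d.+1 in zS KS bound_d1 sa ua sb ub *.
set g := fun x => pile v (2 * (z - z')) x + (ga x + gb x).
(* Each child passes up [z'] of its [2 z'] pebbles, and [2 (z - z') + z' + z' = 2 z]. *)
have up : gathers g (pile v (2 * z)).
  rewrite edge_sym in va; rewrite edge_sym in vb.
  have ua' := gathers_trans ua (gathers_edge (n := z') va).
  have ub' := gathers_trans ub (gathers_edge (n := z') vb).
  apply: gathersW (gathersD (@gathers_refl _ _) (gathersD ua' ub')) _ _.
    by move=> x; exact: leqnn.
  by move=> x; rewrite /pile; lia.
(* The sibling [w'] sends [z'] pebbles to [v], which passes on half of its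
   pebbles to [w]. *)
have down w w' gw gw' : edge v w -> edge v w' -> (forall x, gw x + gw' x = ga x + gb x) ->
    gathers gw' (pile w' (2 * z')) ->
    gathers (fun x => g x + pile v (surplus d) x)
            (fun x => gw x + pile w (surplus d.+1) x).
  move=> vw vw' eq_g uw'; rewrite edge_sym in vw'.
  have uw := gathers_trans uw' (gathers_edge (n := z') vw').
  pose rest := pile v (2 * (z - z') + surplus d).
  have := gathersD (gathers_refl (f := gw))
            (gathersD (gathers_refl (f := rest)) uw).
  set l := fun x => _ + _ => gath.
  (* By [K_d = z' + 2 K_(d+1)], the pile [2 (z - z') + surplus d + z'] at [v] is exactly
     [2 * surplus d.+1]. *)
  have {}gath : gathers l (fun x => gw x + pile v (2 * surplus d.+1) x).
    apply: gathersW gath _ _ => x //; rewrite /rest /pile /surplus -/z -/z'.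
    by case: (x == v); lia.
  have := gathers_trans gath (gathersD (gathers_refl (f := gw))
                                (gathers_edge (n := surplus d.+1) vw)).
  move/gathersW; apply=> x //; have := eq_g x.
  by rewrite /l /rest /g /pile; lia.
exists g; split=> //.
  by rewrite !big_split /= sum_pile sa sb KS; lia.
case=> [_|x q /= /andP[vx xq]].
  have := gathersD up (gathers_refl (f := pile v (surplus d))).
  move/gathersW; apply=> // x; rewrite /= /pile /surplus -/z.
  (* If [z = 0] then [K_d = 0] and the surplus is [2^(h-d) > 0]; otherwise the [2 z] pebbles
     suffice. *)
  have K0 := @parts_sum_eq0 p d; rewrite -/z in K0.
  by have := expn_gt0 2 (h - d); lia.
move: vx xq; rewrite eq_ab !inE => /orP[]/eqP-> xq.
  exact: gathers_trans (down a b ga gb va vb (fun=> erefl) ub) (ca q xq).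
by apply: gathers_trans (down b a gb ga vb va _ ua) (cb q xq) => y; exact: addnC.
Qed.

Lemma opt_pebbling_binary_tree : opt_pebbling T <= 2 ^ h - parts_sum p 0.
Proof.
have d0 : dist r r = 0 by apply/eqP; rewrite -leqn0; exact: (@dist_le T r [::]).
have [g] := subtree_config r; rewrite /= d0 => -[sum_g _ down].
have le_opt := @opt_pebbling_le T (fun x => g x + pile r (surplus 0) x).
apply: leq_trans (le_opt _) _ => [u|].
  by have [q rq <-] := child_pathP u; exact: down.
(* With [z = z_0] and [K = K_0]: [(2 z + 2 K) + (2^h - 3 K - 2 z) = 2^h - K]. *)
by rewrite big_split /= sum_pile sum_g /surplus subn0; lia.
Qed.

End BinaryTree.

Theorem theorem3p4 (h : nat) (T : sgraph) (r : T)
  (hT : complete_binary_tree r h) :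
  opt_pebbling T <= 2 ^ h - k_max h.
Proof.
rewrite /k_max; case: ex_maxnP => k le_k _; have [p [pk sk]] := s_seq_parts k.
by rewrite -pk; apply: (opt_pebbling_binary_tree hT); lia.
Qed.
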